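(* Let $(X,\mu,T_M)$ be a complete random normed space, where $T_M(a,b)=\min(a,b)$, and let $p,q$ be real numbers such that the quadratic equation $x^2-px+q=0$ has distinct real solutions $\alpha$ and $\beta$ with $0<|\beta|<|\alpha|<1$. If a mapping $f\colon\mathbb{R}\to X$ satisfies, for all $x\in\mathbb{R}$ and $t>0$, $$\mu_{f(x)-pf(x-1)+qf(x-2)}(t)\ge \frac{1}{\sqrt{2\pi}}\int_{-\infty}^{t-x}e^{-u^2/2}\,du,$$ then there exists a mapping $F\colon\mathbb{R}\to X$ satisfying $$F(x)=pF(x-1)-qF(x-2)\quad\text{for all } x\in\mathbb{R}$$ and $$\mu_{f(x)-F(x)}(t)\ge \frac{1}{\sqrt{2\pi}}\int_{-\infty}^{\gamma t-x}e^{-u^2/2}\,du\quad\text{for all } x\in\mathbb{R}\text{ and } t>0,$$ where $$\gamma=\frac{|\alpha-\beta|\,(1-|\alpha|)\,(1-|\beta|)}{|\alpha|+|\beta|-2|\alpha||\beta|}.$$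
   Context: Distribution functions: $\Delta^+$ is the set of all mappings $F\colon\mathbb{R}\cup\{+\infty,-\infty\}\to[0,1]$ that are left continuous and non-decreasing (left continuity is understood at the points of $\mathbb{R}$) with $F(0)=0$ and $F(+\infty)=1$. $D^+$ is the subset of those $F\in\Delta^+$ with $\lim_{t\to+\infty}F(t)=1$. The function $\varepsilon_0\in\Delta^+$ is given by $\varepsilon_0(t)=0$ for $t\le 0$ and $\varepsilon_0(t)=1$ for $t>0$. A triangular norm ($t$-norm) is a mapping $T\colon[0,1]\times[0,1]\to[0,1]$ that is commutative and associative, satisfies $T(a,1)=a$ for all $a\in[0,1]$, and satisfies $T(a,b)\le T(c,d)$ whenever $a\le c$ and $b\le d$. The minimum $t$-norm is $T_M(a,b)=\min(a,b)$. A random normed space (RN-space) is a triple $(X,\mu,T)$ where $X$ is a (real) vector space, $T$ is a $t$-norm, and $\mu\colon X\to D^+$ is a mapping ($\mu(x)$ is denoted $\mu_x$) such that: (RN1) $\mu_x(t)=\varepsilon_0(t)$ for all $t>0$ if and only if $x=0$; (RN2) $\mu_{\beta x}(t)=\mu_x(t/|\beta|)$ for all $x\in X$ and scalars $\beta\neq0$; (RN3) $\mu_{x+y}(t+s)\ge T(\mu_x(t),\mu_y(s))$ for all $x,y\in X$ and $t,s\ge0$. A sequence $\{x_n\}$ in $X$ converges to $x\in X$ if for every $\varepsilon>0$ and $\lambda>0$ there is a positive integer $N$ such that $\mu_{x_n-x}(\varepsilon)>1-\lambda$ whenever $n\ge N$. It is a Cauchy sequence if for every $\varepsilon>0$ and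 $\lambda>0$ there is a positive integer $N$ such that $\mu_{x_n-x_m}(\varepsilon)>1-\lambda$ whenever $n\ge m\ge N$. The RN-space is complete if every Cauchy sequence in $X$ converges to a point of $X$. *)

(* Defs.v *)
From HB Require Import structures.
From mathcomp Require Import all_boot all_order all_algebra.
From mathcomp Require Import all_classical all_reals all_analysis.
Set Implicit Arguments.
Unset Strict Implicit.
Unset Printing Implicit Defensive.
Import Order.TTheory GRing.Theory Num.Theory.
Import numFieldNormedType.Exports.
Local Open Scope classical_set_scope.
Local Open Scope ring_scope.

(* Left continuity is only required at the real points of the domain [\bar R]. *)
Record is_Delta_plus (R : realType) (F : \bar R -> R) : Prop := {
  Delta_plus_itv : forall t : \bar R, 0 <= F t <= 1 ;
  Delta_plus_homo : forall s t : \bar R, (s <= t)%E -> F s <= F t ;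
  Delta_plus_left_continuous :
    forall a : R, F t%:E @[t --> a^'-] --> F a%:E ;
  Delta_plus_0 : F 0%E = 0 ;
  Delta_plus_pinfty : F +oo%E = 1
}.

Definition is_D_plus (R : realType) (F : \bar R -> R) : Prop :=
  is_Delta_plus F /\ (F t%:E @[t --> +oo] --> (1 : R)).

Definition eps0 (R : realType) (t : \bar R) : R :=
  if (t <= 0)%E then 0 else 1.

(* A t-norm is a binary operation on [0, 1]; here it is a function on R whose
   values outside the unit square are irrelevant. *)
Record is_tnorm (R : realType) (T : R -> R -> R) : Prop := {
  tnorm_itv : forall a b, 0 <= a <= 1 -> 0 <= b <= 1 -> 0 <= T a b <= 1 ;
  tnormC : forall a b, 0 <= a <= 1 -> 0 <= b <= 1 -> T a b = T b a ;
  tnormA : forall a b c, 0 <= a <= 1 -> 0 <= b <= 1 -> 0 <= c <= 1 ->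
    T a (T b c) = T (T a b) c ;
  tnorm1 : forall a, 0 <= a <= 1 -> T a 1 = a ;
  tnorm_homo : forall a b c d,
    0 <= a <= 1 -> 0 <= b <= 1 -> 0 <= c <= 1 -> 0 <= d <= 1 ->
    a <= c -> b <= d -> T a b <= T c d
}.

Definition TM (R : realType) (a b : R) : R := Num.min a b.

(* In RN2 and RN3 the arguments t, s are real: at +oo and -oo every member of
   Delta^+ takes the values 1 and 0. *)
Record is_RN_space (R : realType) (X : lmodType R)
    (mu : X -> \bar R -> R) (T : R -> R -> R) : Prop := {
  RN_tnorm : is_tnorm T ;
  RN_D_plus : forall x, is_D_plus (mu x) ;
  RN1 : forall x, (forall t : R, 0 < t -> mu x t%:E = eps0 t%:E) <-> x = 0 ;
  RN2 : forall (x : X) (b t : R), b != 0 ->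
    mu (b *: x) t%:E = mu x (t / `|b|)%:E ;
  RN3 : forall (x y : X) (t s : R), 0 <= t -> 0 <= s ->
    T (mu x t%:E) (mu y s%:E) <= mu (x + y) (t + s)%:E
}.

Definition RN_converges (R : realType) (X : lmodType R)
    (mu : X -> \bar R -> R) (u : nat -> X) (x : X) : Prop :=
  forall e l : R, 0 < e -> 0 < l ->
  exists2 N : nat, (0 < N)%N &
    forall n, (N <= n)%N -> 1 - l < mu (u n - x) e%:E.

Definition RN_cauchy (R : realType) (X : lmodType R)
    (mu : X -> \bar R -> R) (u : nat -> X) : Prop :=
  forall e l : R, 0 < e -> 0 < l ->
  exists2 N : nat, (0 < N)%N &
    forall n m, (N <= m)%N -> (m <= n)%N -> 1 - l < mu (u n - u m) e%:E.

Definition is_complete_RN_space (R : realType) (X : lmodType R)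
    (mu : X -> \bar R -> R) (T : R -> R -> R) : Prop :=
  is_RN_space mu T /\
  forall u : nat -> X, RN_cauchy mu u -> exists x : X, RN_converges mu u x.

Definition gauss_cdf (R : realType) (s : R) : R :=
  1 / Num.sqrt (2 * pi) *
  \int[lebesgue_measure]_(u in `]-oo, s]) expR (- (u ^+ 2) / 2).

(* Main.v *)
Require Import Defs.
From HB Require Import structures.
From mathcomp Require Import all_boot all_order all_algebra.
From mathcomp Require Import all_classical all_reals all_analysis.
From mathcomp Require Import ring lra.
Set Implicit Arguments.
Unset Strict Implicit.
Unset Printing Implicit Defensive.
Import Order.TTheory GRing.Theory Num.Theory.
Import numFieldNormedType.Exports.
Local Open Scope classical_set_scope.
Local Open Scope ring_scope.

(** Write D(x) = f(x) - p f(x-1) + q f(x-2), and let r be one of the two roots.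
The equation S(x) = D(x) + r S(x-1) is solved by the series
S_r(x) = sum_k r^k D(x-k). Because r is a root, r S_r satisfies the second
order equation with right-hand side r D(x) - q D(x-1) ([root_geom_series]); the
term q D(x-1) is common to both roots, so
E = (alpha S_alpha - beta S_beta) / (alpha - beta) has right-hand side exactly
D, and F = f - E is an exact solution.

The bound on E = f - F rests on the min t-norm: if every term of a sum exceeds
the level c at its own argument t_k, then the sum exceeds the same level c at
the sum of the t_k. For S_r take t_k = |r|^k t. Scaling turns the k-th
condition into one on D(x-k) at t, whose lower bound phi(t - x + k), with phi
the Gaussian distribution function, is at least phi(t - x). Hence
mu_{S_r(x)}(t / (1 - |r|)) >= phi(t - x) ([geom_series_sum]). Adding the two
series gives the factor
(|alpha| / (1 - |alpha|) + |beta| / (1 - |beta|)) / |alpha - beta|, which is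
1 / gamma.

About phi the argument uses that it is nondecreasing, bounded by 1 and gets
arbitrarily close to 1; the last point makes the tails of the series small,
because the tail from m on has the lower bound phi(t - x + m). *)

(** * Levels in random normed spaces *)

Lemma RN_le1 (R : realType) (X : lmodType R) (mu : X -> \bar R -> R)
  (T : R -> R -> R) (x : X) (t : \bar R) : is_RN_space mu T -> mu x t <= 1.
Proof.
by move=> hmu; have [[+ _ _ _ _] _] := RN_D_plus hmu x => /(_ t)/andP[].
Qed.

Lemma RN_homo (R : realType) (X : lmodType R) (mu : X -> \bar R -> R)
  (T : R -> R -> R) (x : X) (s t : R) :
  is_RN_space mu T -> s <= t -> mu x s%:E <= mu x t%:E.
Proof.
move=> hmu st; have [[_ + _ _ _] _] := RN_D_plus hmu x.
by apply; rewrite lee_fin.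
Qed.

Lemma RN_at0 (R : realType) (X : lmodType R) (mu : X -> \bar R -> R)
  (T : R -> R -> R) (t : R) : is_RN_space mu T -> 0 < t -> mu 0 t%:E = 1.
Proof.
move=> hmu t0; rewrite (RN1 hmu 0).2// /eps0.
by rewrite lee_fin leNgt t0.
Qed.

Lemma RN_eq0 (R : realType) (X : lmodType R) (mu : X -> \bar R -> R)
  (T : R -> R -> R) (x : X) : is_RN_space mu T ->
  (forall e l : R, 0 < e -> 0 < l -> 1 - l < mu x e%:E) -> x = 0.
Proof.
move=> hmu h; apply/(RN1 hmu) => t t0.
rewrite /eps0 lee_fin leNgt t0 /=.
apply/le_anti; rewrite (RN_le1 _ _ hmu)/=.
apply/ler_addgt0Pr => l l0; have := h t l t0 l0; lra.
Qed.

Lemma RN_opp (R : realType) (X : lmodType R) (mu : X -> \bar R -> R)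
  (T : R -> R -> R) (x : X) (t : R) :
  is_RN_space mu T -> mu (- x) t%:E = mu x t%:E.
Proof.
move=> hmu; rewrite -scaleN1r (RN2 hmu) ?oppr_eq0 ?oner_neq0//.
by rewrite normrN1 divr1.
Qed.

Lemma RN_scale (R : realType) (X : lmodType R) (mu : X -> \bar R -> R)
  (T : R -> R -> R) (b : R) (x : X) (t : R) :
  is_RN_space mu T -> b != 0 -> mu (b *: x) (`|b| * t)%:E = mu x t%:E.
Proof.
by move=> hmu b0; rewrite (RN2 hmu)// mulrAC divff ?normr_eq0// mul1r.
Qed.

(** With the min t-norm a level common to both summands passes to the sum, with
no loss however many terms are added. *)
Lemma RN_add (R : realType) (X : lmodType R) (mu : X -> \bar R -> R)
  (c : R) (x y : X) (s t : R) : is_RN_space mu (@TM R) ->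
  0 <= s -> 0 <= t -> c <= mu x s%:E -> c <= mu y t%:E ->
  c <= mu (x + y) (s + t)%:E.
Proof.
move=> hmu s0 t0 cx cy; apply: le_trans (RN3 hmu x y s0 t0).
by rewrite /TM le_min cx cy.
Qed.

Lemma RN_add_lt (R : realType) (X : lmodType R) (mu : X -> \bar R -> R)
  (c : R) (x y : X) (s t : R) : is_RN_space mu (@TM R) ->
  0 <= s -> 0 <= t -> c < mu x s%:E -> c < mu y t%:E ->
  c < mu (x + y) (s + t)%:E.
Proof.
move=> hmu s0 t0 cx cy; apply: lt_le_trans (RN3 hmu x y s0 t0).
by rewrite /TM lt_min cx cy.
Qed.

(** * Limits *)

Lemma RN_converges_unique (R : realType) (X : lmodType R)
  (mu : X -> \bar R -> R) (u : nat -> X) (x y : X) :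
  is_RN_space mu (@TM R) ->
  RN_converges mu u x -> RN_converges mu u y -> x = y.
Proof.
move=> hmu ux uy; apply/eqP; rewrite -subr_eq0; apply/eqP.
apply: (RN_eq0 hmu) => e l e0 l0.
have e2 : 0 < e / 2 by rewrite divr_gt0.
have [N _ hN] := ux _ _ e2 l0; have [M _ hM] := uy _ _ e2 l0.
pose n := maxn N M.
rewrite [e]splitr -[x](subrK (u n)) -addrA.
apply: (RN_add_lt hmu); [exact: ltW|exact: ltW| |].
  by rewrite -[x - u n]opprB (RN_opp _ _ hmu) hN// leq_maxl.
by rewrite hM// leq_maxr.
Qed.

Lemma RN_converges_affine (R : realType) (X : lmodType R)
  (mu : X -> \bar R -> R) (T : R -> R -> R) (a : X) (b : R) (u : nat -> X)
  (x : X) : is_RN_space mu T -> b != 0 ->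
  RN_converges mu u x -> RN_converges mu (fun n => a + b *: u n) (a + b *: x).
Proof.
move=> hmu b0 ux e l e0 l0.
have [|N N0 hN] := ux (e / `|b|) l _ l0.
  by rewrite divr_gt0 // normr_gt0.
exists N => // n /hN.
by rewrite opprD addrACA subrr add0r -scalerBr (RN2 hmu).
Qed.

Lemma RN_converges_shift (R : realType) (X : lmodType R)
  (mu : X -> \bar R -> R) (u : nat -> X) (x : X) :
  RN_converges mu u x -> RN_converges mu (fun n => u n.+1) x.
Proof.
move=> ux e l e0 l0; have [N N0 hN] := ux e l e0 l0.
by exists N => // n Nn; apply: hN; exact: leqW.
Qed.

(** The arbitrary e > 0 added to the argument comes from splitting the limit as
u n + (x - u n). *)
Lemma RN_limit_ge (R : realType) (X : lmodType R)
  (mu : X -> \bar R -> R) (u : nat -> X) (x : X) (c t e : R) :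
  is_RN_space mu (@TM R) -> RN_converges mu u x -> 0 <= t -> 0 < e ->
  (forall n, c <= mu (u n) t%:E) -> c <= mu x (t + e)%:E.
Proof.
move=> hmu ux t0 e0 hc; apply/ler_addgt0Pr => l l0.
have [N _ hN] := ux e l e0 l0.
have uN : c - l <= mu (u N) t%:E by apply: le_trans (hc N); lra.
have xu : c - l <= mu (x - u N) e%:E.
  rewrite -[x - u N]opprB (RN_opp _ _ hmu).
  apply: le_trans (ltW (hN N (leqnn _))).
  by have := le_trans (hc N) (RN_le1 _ _ hmu); lra.
have := RN_add hmu t0 (ltW e0) uN xu.
by rewrite [u N + _]addrC subrK; lra.
Qed.

(** * Geometric series *)

(** The partial sum of r^k D(x - k) over k < n, in Horner form so that
inductions on n move the base point x. *)
Fixpoint geom_sum (R : realType) (X : lmodType R) (r : R) (D : R -> X)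
    (n : nat) (x : R) : X :=
  if n is m.+1 then D x + r *: geom_sum r D m (x - 1) else 0.

Lemma geom_sum_tail (R : realType) (X : lmodType R) (r : R) (D : R -> X)
  (m n : nat) (x : R) : geom_sum r D (m + n) x - geom_sum r D m x =
    r ^+ m *: geom_sum r D n (x - m%:R).
Proof.
elim: m x => [|m IH] x; first by rewrite add0n !subr0 expr0 scale1r.
rewrite addSn /= opprD addrACA subrr add0r -scalerBr IH scalerA -exprS.
by congr (_ *: geom_sum _ _ _ _); rewrite -addn1 natrD; ring.
Qed.

(** By induction on n with the base point free: the first term uses up t, and
the remaining terms, based at x - 1, use up |r| t / (1 - |r|); the shift only
raises the lower bound phi(t - x), as phi is nondecreasing. *)
Lemma geom_sum_bound (R : realType) (X : lmodType R) (mu : X -> \bar R -> R)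
  (phi : R -> R) (r : R) (D : R -> X) :
  is_RN_space mu (@TM R) ->
  {homo phi : s t / s <= t} -> (forall s, phi s <= 1) ->
  r != 0 -> `|r| < 1 ->
  (forall x t : R, 0 < t -> phi (t - x) <= mu (D x) t%:E) ->
  forall n (x t : R), 0 < t ->
    phi (t - x) <= mu (geom_sum r D n x) (t / (1 - `|r|))%:E.
Proof.
move=> hmu phih phi1 r0 r1 hD; elim=> [|n IH] x t t0 /=.
  by rewrite (RN_at0 hmu) ?phi1// divr_gt0// subr_gt0.
have d0 : 0 < 1 - `|r| by rewrite subr_gt0.
have -> : t / (1 - `|r|) = t + `|r| * (t / (1 - `|r|)).
  by field; rewrite gt_eqF.
apply: (RN_add hmu); [exact: ltW| |exact: hD|].
  by rewrite mulr_ge0// divr_ge0// ltW.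
rewrite (RN_scale _ _ hmu r0); apply: le_trans (IH (x - 1) t t0).
by apply: phih; lra.
Qed.

(** The tail from m on is r^m times a partial sum based at x - m, whose lower
bound phi(t - x + m) is as close to 1 as desired for m large. *)
Lemma geom_sum_cauchy (R : realType) (X : lmodType R) (mu : X -> \bar R -> R)
  (phi : R -> R) (r : R) (D : R -> X) :
  is_RN_space mu (@TM R) ->
  {homo phi : s t / s <= t} -> (forall s, phi s <= 1) ->
  (forall l, 0 < l -> exists A, 1 - l < phi A) ->
  r != 0 -> `|r| < 1 ->
  (forall x t : R, 0 < t -> phi (t - x) <= mu (D x) t%:E) ->
  forall x, RN_cauchy mu (fun n => geom_sum r D n x).
Proof.
move=> hmu phih phi1 philim r0 r1 hD x e l e0 l0.
have d0 : 0 < 1 - `|r| by rewrite subr_gt0.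
have [A hA] := philim l l0.
exists (Num.bound `|A + x|).+1 => // n m Nm mn.
rewrite -(subnKC mn) geom_sum_tail.
apply: (lt_le_trans hA).
pose t := e * (1 - `|r|); have t0 : 0 < t by rewrite mulr_gt0.
have Am : A <= t - (x - m%:R).
  have : `|A + x| < m%:R.
    apply: lt_le_trans (archi_boundP (normr_ge0 _)) _.
    by rewrite ler_nat ltnW.
  by rewrite ltr_norml => /andP[_ +]; move: t0; lra.
apply: (le_trans (phih _ _ Am)).
apply: le_trans (geom_sum_bound hmu phih phi1 r0 r1 hD (n - m) (x - m%:R) t0) _.
rewrite /t mulfK ?gt_eqF// -[leLHS](RN_scale _ _ hmu (expf_neq0 m r0)).
apply: (RN_homo _ hmu); apply: ler_piMl; first exact: ltW.
by rewrite normrX exprn_ile1// ltW.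
Qed.

(** Passing to the limit in [geom_sum_bound] costs a positive amount in the
argument. To get the constant 1 / (1 - |r|) exactly, only the terms after
the first are taken as a limit: they are based at x - 1, which leaves room to
start their estimate at t - d instead of t for some d <= 1, and the d so gained
pays for the limit. *)
Lemma geom_series_sum (R : realType) (X : lmodType R) (mu : X -> \bar R -> R)
  (phi : R -> R) (r : R) (D : R -> X) :
  is_complete_RN_space mu (@TM R) ->
  {homo phi : s t / s <= t} -> (forall s, phi s <= 1) ->
  (forall l, 0 < l -> exists A, 1 - l < phi A) ->
  r != 0 -> `|r| < 1 ->
  (forall x t : R, 0 < t -> phi (t - x) <= mu (D x) t%:E) ->
  exists S : R -> X, (forall x, S x = D x + r *: S (x - 1)) /\
    (forall x t : R, 0 < t -> phi (t - x) <= mu (S x) (t / (1 - `|r|))%:E).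
Proof.
move=> [hmu complete] phih phi1 philim r0 r1 hD.
have d0 : 0 < 1 - `|r| by rewrite subr_gt0.
have /choice[S hS] : forall x, exists y,
    RN_converges mu (fun n => geom_sum r D n x) y.
  by move=> x; apply: complete; exact: (geom_sum_cauchy hmu phih).
have SE x : S x = D x + r *: S (x - 1).
  apply: (RN_converges_unique hmu (RN_converges_shift (hS x))).
  exact: (RN_converges_affine _ hmu r0 (hS (x - 1))).
exists S; split=> // x t t0.
(* d <= 1 keeps t - d - (x - 1) above t - x; d < t keeps t - d positive. *)
pose d := Num.min 1 (t / 2).
have dgt0 : 0 < d by rewrite lt_min ltr01 divr_gt0.
have d1 : d <= 1 by rewrite ge_min lexx.
have dt : d < t by rewrite gt_min; apply/orP; right; lra.
rewrite SE.
have -> : t / (1 - `|r|) =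
    t + `|r| * ((t - d) / (1 - `|r|) + d / (1 - `|r|)).
  by field; rewrite gt_eqF.
have td0 : 0 < t - d by rewrite subr_gt0.
have q0 : 0 <= (t - d) / (1 - `|r|) by rewrite divr_ge0// ltW.
have e0 : 0 < d / (1 - `|r|) by rewrite divr_gt0.
apply: (RN_add hmu); [exact: ltW| |exact: hD|].
  by rewrite mulr_ge0// addr_ge0// ltW.
rewrite (RN_scale _ _ hmu r0).
apply: le_trans (RN_limit_ge hmu (hS (x - 1)) q0 e0 (fun n =>
  geom_sum_bound hmu phih phi1 r0 r1 hD n (x - 1) td0)).
by apply: phih; lra.
Qed.

(** * Second order recurrences *)

(** The coefficient of S(x - 1) collapses to -q because r is a root, and then
-q (S(x - 1) - r S(x - 2)) = -q D(x - 1). *)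
Lemma root_geom_series (R : realType) (X : lmodType R) (p q r : R)
  (D S : R -> X) (x : R) : r ^+ 2 - p * r + q = 0 ->
  (forall y, S y = D y + r *: S (y - 1)) ->
  r *: S x - p *: (r *: S (x - 1)) + q *: (r *: S (x - 2)) =
    r *: D x - q *: D (x - 1).
Proof.
move=> hr SE.
have x2 : x - 1 - 1 = x - 2 by ring.
have rE : r * r - p * r = - q.
  by move: hr; rewrite expr2 => /eqP; rewrite addr_eq0 => /eqP.
rewrite (SE x) scalerDr !scalerA -!addrA; congr (_ + _).
rewrite addrA -scalerBl rE (SE (x - 1)) x2.
by rewrite scalerDr scalerA mulNr scaleNr -addrA scaleNr addNr addr0.
Qed.

Lemma subrBD_exchange (V : zmodType) (a b c d e g : V) :
  (a - b) - (c - d) + (e - g) = (a - c + e) - (b - d + g).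
Proof.
rewrite !opprD !opprK [RHS]addrACA; congr (_ + _).
by rewrite addrACA.
Qed.

(** Subtracting the two first order series, weighted by their roots, cancels the
term q D(x - 1) that both produce and leaves (alpha - beta) D(x). *)
Lemma second_order_stability (R : realType) (X : lmodType R)
  (mu : X -> \bar R -> R)
  (phi : R -> R) (p q alpha beta : R) (f : R -> X) :
  is_complete_RN_space mu (@TM R) ->
  {homo phi : s t / s <= t} -> (forall s, phi s <= 1) ->
  (forall l, 0 < l -> exists A, 1 - l < phi A) ->
  alpha ^+ 2 - p * alpha + q = 0 -> beta ^+ 2 - p * beta + q = 0 ->
  alpha != beta -> alpha != 0 -> beta != 0 -> `|alpha| < 1 -> `|beta| < 1 ->
  (forall x t : R, 0 < t ->
    phi (t - x) <= mu (f x - p *: f (x - 1) + q *: f (x - 2)) t%:E) ->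
  exists F : R -> X,
    (forall x : R, F x = p *: F (x - 1) - q *: F (x - 2)) /\
    (forall x t : R, 0 < t -> phi (t - x) <= mu (f x - F x)
      ((t * (`|alpha| / (1 - `|alpha|) + `|beta| / (1 - `|beta|)))
        / `|alpha - beta|)%:E).
Proof.
move=> hX phih phi1 philim halpha hbeta hneq a0 b0 a1 b1 hf.
pose D x := f x - p *: f (x - 1) + q *: f (x - 2).
have [A [AE hA]] := geom_series_sum hX phih phi1 philim a0 a1 (D := D) hf.
have [B [BE hB]] := geom_series_sum hX phih phi1 philim b0 b1 (D := D) hf.
have ab0 : alpha - beta != 0 by rewrite subr_eq0.
have hmu := hX.1.
pose E x := (alpha - beta)^-1 *: (alpha *: A x - beta *: B x).
have EE x : E x - p *: E (x - 1) + q *: E (x - 2) = D x.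
  have hEl c d (u v : X) : c *: ((alpha - beta)^-1 *: (d *: u - beta *: v)) =
      (alpha - beta)^-1 *: (c *: (d *: u) - c *: (beta *: v)).
    by rewrite scalerA mulrC -scalerA scalerBr.
  rewrite /E !hEl -scalerBr -scalerDr.
  apply: (scalerI ab0); rewrite scalerA divff// scale1r.
  transitivity ((alpha *: A x - p *: (alpha *: A (x - 1))
      + q *: (alpha *: A (x - 2))) - (beta *: B x
      - p *: (beta *: B (x - 1)) + q *: (beta *: B (x - 2)))).
    exact: subrBD_exchange.
  rewrite (root_geom_series _ halpha AE) (root_geom_series _ hbeta BE).
  by rewrite opprB addrA subrK scalerBl.
exists (fun x => f x - E x); split=> [x|x t t0].
  have : (f x - E x) - p *: (f (x - 1) - E (x - 1)) +
      q *: (f (x - 2) - E (x - 2)) = 0.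
    by rewrite !scalerBr subrBD_exchange EE subrr.
  by move/eqP; rewrite addrAC subr_eq0 eq_sym -subr_eq eq_sym => /eqP.
rewrite subKr /E.
have := subr_gt0 `|alpha| 1; have := subr_gt0 `|beta| 1; rewrite a1 b1 => db da.
rewrite mulrC -normfV (RN_scale _ _ hmu) ?invr_neq0//.
rewrite (_ : t * _ = `|alpha| * (t / (1 - `|alpha|)) +
  `|beta| * (t / (1 - `|beta|))); last by ring.
apply: (RN_add hmu).
- by rewrite mulr_ge0// divr_ge0// ltW.
- by rewrite mulr_ge0// divr_ge0// ltW.
- by rewrite (RN_scale _ _ hmu)// hA.
- by rewrite (RN_opp _ _ hmu) (RN_scale _ _ hmu)// hB.
Qed.

(** * The Gaussian distribution function *)

(** Identifying the integral with a probability gives monotonicity, the bound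
by 1 and the limit at infinity from measure theory. *)
Lemma gauss_cdfE (R : realType) (s : R) :
  gauss_cdf s = fine (normal_prob (0 : R) 1 `]-oo, s]).
Proof.
have c0 : Num.sqrt (2 * pi) != 0 :> R.
  by rewrite gt_eqF// sqrtr_gt0 mulr_gt0// pi_gt0.
rewrite /gauss_cdf.
under eq_Rintegral => u _.
  rewrite (_ : expR _ = Num.sqrt (2 * pi) * normal_pdf 0 1 u); first over.
  rewrite normal_pdfE ?oner_neq0// /normal_peak /normal_fun subr0.
  by rewrite expr1n mul1r mulr_natl mulrA -[pi *+ 2]mulr_natl divff// mul1r.
rewrite RintegralZl//; first by rewrite mulrA div1r mulVf// mul1r.
by apply: (integrableS _ _ _ (integrable_normal_pdf 0 1)).
Qed.

Lemma gauss_cdf_homo (R : realType) :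
  {homo @gauss_cdf R : s t / s <= t}.
Proof.
move=> s t st; rewrite !gauss_cdfE fine_le ?fin_num_measure//.
by rewrite le_measure ?inE//; exact: subitvPr.
Qed.

Lemma gauss_cdf_le1 (R : realType) (s : R) : gauss_cdf s <= 1.
Proof.
by rewrite gauss_cdfE -lee_fin fineK ?fin_num_measure// probability_le1.
Qed.

Lemma gauss_cdf_near1 (R : realType) (l : R) :
  0 < l -> exists A : R, 1 - l < gauss_cdf A.
Proof.
move=> l0.
have homo : {homo (fun n : nat => `]-oo, n%:R]%classic : set R) :
    n m / (n <= m)%N >-> (n <= m)%O}.
  by move=> n m nm; apply/subsetPset; apply: subitvPr; rewrite bnd_simp ler_nat.
have bigcupE : \bigcup_n `]-oo, n%:R]%classic = [set: R].
  apply/seteqP; split=> // x _; exists (Num.bound `|x|) => //=.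
  rewrite in_itv/= ltW// (le_lt_trans (ler_norm x))//.
  exact: archi_boundP.
have : normal_prob (0 : R) 1 `]-oo, n%:R]%classic @[n --> \oo] --> 1%E.
  rewrite -(probability_setT (normal_prob (0 : R) 1)) -bigcupE.
  apply: nondecreasing_cvg_mu => //.
  exact: bigcup_measurable.
move=> /fine_cvgP[_ /cvgr_gt/(_ (1 - l))].
rewrite ltrBlDr ltrDl => /(_ l0)[N _ /(_ N (leqnn N)) /= h].
by exists N%:R; rewrite gauss_cdfE.
Qed.

(** * Gaussian stability *)

Theorem corollary2p2 (R : realType) (X : lmodType R) (mu : X -> \bar R -> R)
  (hX : is_complete_RN_space mu (@TM R))
  (p q alpha beta : R)
  (halpha : alpha ^+ 2 - p * alpha + q = 0)
  (hbeta : beta ^+ 2 - p * beta + q = 0)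
  (hneq : alpha != beta)
  (hbeta0 : 0 < `|beta|) (hlt : `|beta| < `|alpha|) (halpha1 : `|alpha| < 1)
  (f : R -> X)
  (hf : forall x t : R, 0 < t ->
    gauss_cdf (t - x) <= mu (f x - p *: f (x - 1) + q *: f (x - 2)) t%:E) :
  let gamma := `|alpha - beta| * (1 - `|alpha|) * (1 - `|beta|) /
               (`|alpha| + `|beta| - 2 * `|alpha| * `|beta|) in
  exists F : R -> X,
    (forall x : R, F x = p *: F (x - 1) - q *: F (x - 2)) /\
    (forall x t : R, 0 < t ->
      gauss_cdf (gamma * t - x) <= mu (f x - F x) t%:E).
Proof.
move=> gamma.
have a0 : 0 < `|alpha| := lt_trans hbeta0 hlt.
have b1 : `|beta| < 1 := lt_trans hlt halpha1.
have alpha_neq0 : alpha != 0 by rewrite -normr_gt0.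
have beta_neq0 : beta != 0 by rewrite -normr_gt0.
have da : 0 < 1 - `|alpha| by rewrite subr_gt0.
have db : 0 < 1 - `|beta| by rewrite subr_gt0.
have ab0 : 0 < `|alpha - beta| by rewrite normr_gt0 subr_eq0.
have den0 : 0 < `|alpha| + `|beta| - 2 * `|alpha| * `|beta|.
  rewrite (_ : _ - _ =
    `|alpha| * (1 - `|beta|) + `|beta| * (1 - `|alpha|)); last by ring.
  by rewrite addr_gt0// mulr_gt0.
have gamma0 : 0 < gamma by rewrite divr_gt0// !mulr_gt0.
have [F [FE hF]] := second_order_stability hX (@gauss_cdf_homo R)
  (@gauss_cdf_le1 R) (@gauss_cdf_near1 R) halpha hbeta hneq
  alpha_neq0 beta_neq0 halpha1 b1 hf.
exists F; split=> // x t t0.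
rewrite [in leRHS](_ : t = gamma * t *
  (`|alpha| / (1 - `|alpha|) + `|beta| / (1 - `|beta|)) / `|alpha - beta|).
  by apply: hF; rewrite mulr_gt0.
by rewrite /gamma; field; rewrite !gt_eqF.
Qed.
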